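(* Let $M\in\mathbb{R}^{m\times n}$ and $\gamma>0$, and assume $M\neq 0$. Consider the two problems $$\text{(P)}\quad \min_{X,Y\in\mathbb{R}^{m\times n}}\{\|X\|_*+\gamma\|Y\|_1 \ :\ X+Y=M\},\qquad \text{(D)}\quad \min_{Z\in\mathbb{R}^{m\times n}}\{\max\{\|Z\|_2,\|Z\|_\infty/\gamma\}\ :\ \langle M,Z\rangle\geq 1\}.$$ For $X,Y,Z\in\mathbb{R}^{m\times n}$ consider the following six conditions: 1. $X+Y=M$; 2. $\langle M,Z\rangle=1$; 3. $\|Y\|_1\|Z\|_\infty=\langle Y,Z\rangle$; 4. $\sigma_i(X)\,(\|Z\|_2-\sigma_i(Z))=0$ for all $i=1,2,\ldots,\min(m,n)$; 5. $X$ and $Z$ admit a simultaneous ordered SVD; 6. $\|Z\|_2=\|Z\|_\infty/\gamma$. If $(X,Y)$ and $Z$ satisfy conditions 1--6, then $(X,Y)$ is optimal for (P) and $Z$ is optimal for (D). Conversely, if $(X,Y)$ is optimal for (P), $Z$ is optimal for (D), and neither $X$ nor $Y$ is zero, then conditions 1--6 hold.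
   Context: For real $m\times n$ matrices: $\langle A,B\rangle=\operatorname{tr}(A^\top B)$; $\|X\|_*$ is the nuclear norm (sum of the singular values); $\|Y\|_1=\sum_{i,j}|Y_{ij}|$; $\|Z\|_2$ is the spectral norm (largest singular value); $\|Z\|_\infty=\max_{i,j}|Z_{ij}|$. $\sigma(T)$ denotes the vector of singular values $\sigma_1(T)\geq\sigma_2(T)\geq\cdots\geq\sigma_{\min(m,n)}(T)$ of $T$ in nonincreasing order. $X$ and $Z$ admit a simultaneous ordered SVD if there exist orthogonal matrices $U\in\mathbb{R}^{m\times m}$ and $V\in\mathbb{R}^{n\times n}$ with $X=U\,\mathrm{diag}(\sigma(X))V^\top$ and $Z=U\,\mathrm{diag}(\sigma(Z))V^\top$, where $\mathrm{diag}(\cdot)$ is the $m\times n$ (rectangular) diagonal matrix with the given diagonal. *)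

(* Defs.v *)
From mathcomp Require Import all_boot all_order all_algebra.
From mathcomp Require Import polyrcf.
From mathcomp Require Import reals matrix_normedtype.

Set Implicit Arguments.
Unset Strict Implicit.
Unset Printing Implicit Defensive.

Import Order.TTheory GRing.Theory Num.Theory.
Local Open Scope ring_scope.

Section Definitions.
Variable R : realType.

(* Real eigenvalues in nonincreasing order, repeated according to their
   algebraic multiplicity. *)
Definition eigenvalues n (A : 'M[R]_n) : seq R :=
  sort >=%R (flatten [seq nseq (mup a (char_poly A)) a | a <- rootsR (char_poly A)]).

(* Square roots of the eigenvalues of T^T T. When m < n that matrix has at
   least n - m zero eigenvalues; [take] drops the n - m superfluous ones.
   Indices start at 0: sigma_{i+1}(T) is (singular_values T)`_i. *)
Definition singular_values m n (T : 'M[R]_(m, n)) : seq R :=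
  take (minn m n) (map Num.sqrt (eigenvalues (T^T *m T))).

Definition nuclear_norm m n (T : 'M[R]_(m, n)) : R :=
  \sum_(s <- singular_values T) s.

Definition spectral_norm m n (T : 'M[R]_(m, n)) : R :=
  \big[Num.max/0]_(s <- singular_values T) s.

Definition entry_norm1 m n (T : 'M[R]_(m, n)) : R :=
  \sum_(i < m) \sum_(j < n) `|T i j|.

(* [mx_norm] is the maximum of the absolute values of the entries. *)
Definition entry_norm_oo m n (T : 'M[R]_(m, n)) : R := mx_norm T.

Definition mxdot m n (A B : 'M[R]_(m, n)) : R := \tr (A^T *m B).

Definition orthogonal_mx n (U : 'M[R]_n) : Prop := U^T *m U = 1%:M.

Definition rect_diag m n (s : seq R) : 'M[R]_(m, n) :=
  \matrix_(i < m, j < n) (s`_i *+ (i == j :> nat)).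

Definition simultaneous_ordered_svd m n (X Z : 'M[R]_(m, n)) : Prop :=
  exists (U : 'M[R]_m) (V : 'M[R]_n),
    [/\ orthogonal_mx U, orthogonal_mx V,
        X = U *m rect_diag m n (singular_values X) *m V^T &
        Z = U *m rect_diag m n (singular_values Z) *m V^T].

Definition minimizer (T : Type) (feasible : T -> Prop) (f : T -> R) (x : T) :=
  feasible x /\ forall y, feasible y -> f x <= f y.

Definition optimal_P m n (M : 'M[R]_(m, n)) (gamma : R) (X Y : 'M[R]_(m, n)) :=
  minimizer (fun XY : 'M[R]_(m, n) * 'M[R]_(m, n) => XY.1 + XY.2 = M)
    (fun XY => nuclear_norm XY.1 + gamma * entry_norm1 XY.2) (X, Y).

Definition optimal_D m n (M : 'M[R]_(m, n)) (gamma : R) (Z : 'M[R]_(m, n)) :=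
  minimizer (fun Z : 'M[R]_(m, n) => 1 <= mxdot M Z)
    (fun Z => Num.max (spectral_norm Z) (entry_norm_oo Z / gamma)) Z.

Definition optimality_conditions m n (M : 'M[R]_(m, n)) (gamma : R)
    (X Y Z : 'M[R]_(m, n)) : Prop :=
  X + Y = M /\
  mxdot M Z = 1 /\
  entry_norm1 Y * entry_norm_oo Z = mxdot Y Z /\
  (forall i : 'I_(minn m n),
     (singular_values X)`_i * (spectral_norm Z - (singular_values Z)`_i) = 0) /\
  simultaneous_ordered_svd X Z /\
  spectral_norm Z = entry_norm_oo Z / gamma.

End Definitions.

(* Main.v *)
Require Import Defs.
From mathcomp Require Import all_boot all_order all_algebra.
From mathcomp Require Import polyrcf ring lra.
From mathcomp Require Import boolp classical_sets reals topology normedtype.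
From mathcomp Require Import derive.

Set Implicit Arguments.
Unset Strict Implicit.
Unset Printing Implicit Defensive.

Import Order.TTheory GRing.Theory Num.Theory.
Import numFieldNormedType.Exports.
Local Open Scope ring_scope.

(* Write p for the objective of (P) and d for that of (D).  Since the nuclear
   and spectral norms, and the entrywise 1- and max-norms, are dual pairs,
   <X + Y, Z> <= d(Z) p(X, Y) always holds.  Conditions 1-6 force equality, hence
   optimality.  Conversely, the value of (P) is a sublinear function of M, so
   Hahn-Banach yields a Z with d(Z) <= 1 and <M, Z> >= p; thus d p <= 1 at the
   optima, and all the inequalities above are equalities.  In the equality case
   <X, Z> = |Z|_2 |X|_*, every pair of singular vectors of X with positive
   singular value attains |Z|_2, so it splits off as a 1x1 block of Z; an SVD of
   the remaining block of Z completes a simultaneous ordered SVD. *)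

(** * The trace inner product *)

Section InnerProduct.
Variable R : realType.
Implicit Types m n p : nat.

Lemma mxdotE m n (A B : 'M[R]_(m, n)) : mxdot A B = \sum_i \sum_j A i j * B i j.
Proof.
rewrite /mxdot /mxtrace exchange_big; apply: eq_bigr => j _.
by rewrite mxE; apply: eq_bigr => i _; rewrite mxE.
Qed.

Lemma mxdotC m n (A B : 'M[R]_(m, n)) : mxdot A B = mxdot B A.
Proof. by rewrite /mxdot -mxtrace_tr trmx_mul trmxK. Qed.

Lemma mxdotDl m n (A B C : 'M[R]_(m, n)) :
  mxdot (A + B) C = mxdot A C + mxdot B C.
Proof. by rewrite /mxdot linearD mulmxDl linearD. Qed.

Lemma mxdotDr m n (A B C : 'M[R]_(m, n)) :
  mxdot A (B + C) = mxdot A B + mxdot A C.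
Proof. by rewrite mxdotC mxdotDl !(mxdotC A). Qed.

Lemma mxdotZl m n t (A B : 'M[R]_(m, n)) : mxdot (t *: A) B = t * mxdot A B.
Proof. by rewrite /mxdot linearZ -scalemxAl linearZ. Qed.

Lemma mxdotZr m n t (A B : 'M[R]_(m, n)) : mxdot A (t *: B) = t * mxdot A B.
Proof. by rewrite mxdotC mxdotZl mxdotC. Qed.

Lemma mxdotNl m n (A B : 'M[R]_(m, n)) : mxdot (- A) B = - mxdot A B.
Proof. by rewrite -scaleN1r mxdotZl mulN1r. Qed.

Lemma mxdotNr m n (A B : 'M[R]_(m, n)) : mxdot A (- B) = - mxdot A B.
Proof. by rewrite mxdotC mxdotNl mxdotC. Qed.

Lemma mxdot0l m n (A : 'M[R]_(m, n)) : mxdot 0 A = 0.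
Proof. by rewrite -(scale0r 0) mxdotZl mul0r. Qed.

Lemma mxdot_mull m n p (U : 'M[R]_(p, m)) (A : 'M_(m, n)) (B : 'M_(p, n)) :
  mxdot (U *m A) B = mxdot A (U^T *m B).
Proof. by rewrite /mxdot trmx_mul mulmxA. Qed.

Lemma mxdot_mulr m n p (V : 'M[R]_(n, p)) (A : 'M_(m, n)) (B : 'M_(m, p)) :
  mxdot (A *m V) B = mxdot A (B *m V^T).
Proof. by rewrite /mxdot trmx_mul -mulmxA mxtrace_mulC mulmxA. Qed.

Lemma mxdot_ge0 m n (A : 'M[R]_(m, n)) : 0 <= mxdot A A.
Proof.
by rewrite mxdotE; do 2!apply: sumr_ge0 => ? _; rewrite -expr2 sqr_ge0.
Qed.

Lemma mxdot_eq0 m n (A : 'M[R]_(m, n)) : (mxdot A A == 0) = (A == 0).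
Proof.
apply/eqP/eqP => [|->]; last by rewrite mxdot0l.
rewrite mxdotE => /eqP; rewrite psumr_eq0; last first.
  by move=> i _; apply: sumr_ge0 => ? _; rewrite -expr2 sqr_ge0.
move=> /allP h; apply/matrixP => i j; rewrite mxE.
have := h i; rewrite mem_index_enum => /(_ isT) /=.
rewrite psumr_eq0; last by move=> ? _; rewrite -expr2 sqr_ge0.
move=> /allP /(_ j); rewrite mem_index_enum => /(_ isT) /=.
by rewrite mulf_eq0 orbb => /eqP.
Qed.

Lemma mxdot_gt0 m n (A : 'M[R]_(m, n)) : (0 < mxdot A A) = (A != 0).
Proof. by rewrite lt0r mxdot_ge0 andbT mxdot_eq0. Qed.

Lemma mxdot_delta m n (A : 'M[R]_(m, n)) i j : mxdot (delta_mx i j) A = A i j.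
Proof.
rewrite mxdotE (bigD1 i) //= (bigD1 j) //= !mxE !eqxx mul1r.
rewrite big1 => [|k /negbTE nk]; last by rewrite mxE eqxx nk mul0r.
rewrite big1 ?addr0 // => k /negbTE nk.
by rewrite big1 // => l _; rewrite mxE nk mul0r.
Qed.

Lemma mxdot_col_mx m1 m2 n (A B : 'M[R]_(m1, n)) (C D : 'M[R]_(m2, n)) :
  mxdot (col_mx A C) (col_mx B D) = mxdot A B + mxdot C D.
Proof. by rewrite /mxdot tr_col_mx mul_row_col linearD. Qed.

Lemma mxdot_entry m n (A : 'M[R]_(m, n)) i j :
  mxdot (delta_mx i 0 : 'cV_m) (A *m delta_mx j 0) = A i j.
Proof. by rewrite mxdot_delta -colE mxE. Qed.

Lemma mxdot_delta_self n (i : 'I_n) :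
  mxdot (delta_mx i 0 : 'cV[R]_n) (delta_mx i 0) = 1.
Proof. by rewrite mxdot_delta mxE !eqxx. Qed.

End InnerProduct.

(** * Orthogonal matrices *)

Section Orthogonal.
Variable R : realType.

Lemma orthogonal_mx_trK n (U : 'M[R]_n) : orthogonal_mx U -> U *m U^T = 1%:M.
Proof. exact: mulmx1C. Qed.

Lemma orthogonal_mx_tr n (U : 'M[R]_n) :
  orthogonal_mx U -> orthogonal_mx U^T.
Proof. by move=> hU; rewrite /orthogonal_mx trmxK orthogonal_mx_trK. Qed.

Lemma orthogonal_mx1 n : orthogonal_mx (1%:M : 'M[R]_n).
Proof. by rewrite /orthogonal_mx trmx1 mulmx1. Qed.

Lemma orthogonal_mxM n (U V : 'M[R]_n) :
  orthogonal_mx U -> orthogonal_mx V -> orthogonal_mx (U *m V).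
Proof.
rewrite /orthogonal_mx => hU hV.
by rewrite trmx_mul mulmxA -(mulmxA V^T) hU mulmx1.
Qed.

Lemma orthogonal_mx_block n (U : 'M[R]_n) :
  orthogonal_mx U -> orthogonal_mx (block_mx 1%:M 0 0 U : 'M_(1 + n)).
Proof.
rewrite /orthogonal_mx => hU.
rewrite tr_block_mx mulmx_block !trmx0 trmx1 !mulmx0 !mul0mx mulmx1.
by rewrite !addr0 !add0r hU -scalar_mx_block.
Qed.

Lemma mxdot_orthogonal m n (U : 'M[R]_m) (A B : 'M_(m, n)) :
  orthogonal_mx U -> mxdot (U *m A) (U *m B) = mxdot A B.
Proof. by move=> hU; rewrite mxdot_mull mulmxA hU mul1mx. Qed.

(* A Householder reflection exchanges [delta_mx 0 0] and [u]. *)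
Lemma orthogonal_mx_complete n (u : 'cV[R]_n.+1) :
  mxdot u u = 1 -> exists2 U : 'M[R]_n.+1, orthogonal_mx U & col 0 U = u.
Proof.
move=> u1; pose e : 'cV[R]_n.+1 := delta_mx 0 0.
have [->|ue] := eqVneq u e.
  by exists 1%:M; [exact: orthogonal_mx1 | rewrite colE mul1mx].
pose w := u - e; pose c := mxdot w w.
have c0 : c != 0 by rewrite mxdot_eq0 subr_eq0.
have wTw : w^T *m w = c%:M.
  by rewrite [LHS]mx11_scalar /c /mxdot /mxtrace big_ord1.
pose H : 'M[R]_n.+1 := 1%:M - (2 / c) *: (w *m w^T).
have HT : H^T = H by rewrite /H linearB linearZ /= trmx1 trmx_mul trmxK.
exists H.
  rewrite /orthogonal_mx HT {1}/H mulmxBl mul1mx -scalemxAl /H mulmxBr mulmx1.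
  rewrite -scalemxAr -mulmxA (mulmxA w^T) wTw mul_scalar_mx -scalemxAr.
  rewrite scalerBr !scalerA opprB addrA -addrA.
  rewrite -scalerBl -scaleNr -addrA -scalerDl.
  by rewrite [X in X *: _](_ : _ = 0) ?scale0r ?addr0 //; field.
(* For unit vectors, c = 2 - 2 <u, e> and <w, e> = <u, e> - 1 = - c / 2, so that H e = e + w = u. *)
have we : w^T *m e = (- (c / 2))%:M.
  rewrite [LHS]mx11_scalar; congr (_%:M).
  have -> : (w^T *m e) 0 0 = mxdot w e by rewrite /mxdot /mxtrace big_ord1.
  have ee : mxdot e e = 1 by rewrite mxdot_delta_self.
  rewrite /c /w !(mxdotDl, mxdotDr, mxdotNl, mxdotNr) u1 ee (mxdotC e u).
  by field.
rewrite colE -/e /H mulmxBl mul1mx -scalemxAl -mulmxA we mul_mx_scalar scalerA.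
have -> : 2 / c * - (c / 2) = -1 by field.
by rewrite scaleN1r opprK /w addrC subrK.
Qed.

End Orthogonal.

(** * Bounds on bilinear forms, and their equality case *)

Section BilinearBound.
Variable R : realType.

(* [op_bounded Z s] says that the spectral norm of [Z] is at most [s]: by
   homogeneity it is equivalent to [u^T Z v <= s |u| |v|], but it avoids
   Euclidean norms. *)
Definition op_bounded m n (Z : 'M[R]_(m, n)) (s : R) : Prop :=
  forall (u : 'cV_m) (v : 'cV_n),
    2 * mxdot u (Z *m v) <= s * (mxdot u u + mxdot v v).

Lemma mxdot_flat m n (A B : 'M[R]_(m, n)) : minn m n = 0%N -> mxdot A B = 0.
Proof.
move=> mn0; rewrite mxdotE big1 // => i _; rewrite big1 // => j _; exfalso.
have := leq_ltn_trans (leq0n i) (ltn_ord i).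
have := leq_ltn_trans (leq0n j) (ltn_ord j).
by case: m n mn0 {A B i j} => [|m] [|n] //; rewrite minnSS.
Qed.

Lemma flat_mx0 m n (A : 'M[R]_(m, n)) : minn m n = 0%N -> A = 0.
Proof. by move=> mn0; apply/eqP; rewrite -mxdot_eq0 mxdot_flat. Qed.

Lemma mxdot_cauchy m n (A B : 'M[R]_(m, n)) :
  2 * mxdot A B <= mxdot A A + mxdot B B.
Proof.
have := mxdot_ge0 (A - B).
rewrite !(mxdotDl, mxdotDr, mxdotNl, mxdotNr) (mxdotC B A); lra.
Qed.

Lemma mxdot_block m1 m2 n1 n2 (A A' : 'M[R]_(m1, n1)) (B B' : 'M[R]_(m1, n2))
    (C C' : 'M[R]_(m2, n1)) (D D' : 'M[R]_(m2, n2)) :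
  mxdot (block_mx A B C D) (block_mx A' B' C' D') =
  mxdot A A' + mxdot B B' + (mxdot C C' + mxdot D D').
Proof.
have row p q1 q2 (E E' : 'M[R]_(p, q1)) (F F' : 'M[R]_(p, q2)) :
    mxdot (row_mx E F) (row_mx E' F') = mxdot E E' + mxdot F F'.
  by rewrite /mxdot mxtrace_mulC tr_row_mx mul_row_col linearD /=
    !(mxtrace_mulC _ _^T).
by rewrite mxdot_col_mx !row.
Qed.

Lemma rect_diag_cons m n a (s : seq R) :
  rect_diag (1 + m) (1 + n) (a :: s) =
  block_mx a%:M 0 0 (rect_diag m n s) :> 'M_(1 + m, 1 + n).
Proof.
by apply/matrixP => i j; rewrite !mxE; case: splitP => i' Ei; rewrite !mxE;
  case: splitP => j' Ej; rewrite !mxE Ei Ej ?ord1.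
Qed.

Lemma rect_diag_nil m n : rect_diag m n [::] = 0 :> 'M[R]_(m, n).
Proof. by apply/matrixP => i j; rewrite !mxE nth_nil mul0rn. Qed.

Lemma op_bounded_entry m n (Z : 'M[R]_(m, n)) s i j :
  op_bounded Z s -> Z i j <= s.
Proof.
move=> /(_ (delta_mx i 0) (delta_mx j 0)).
rewrite mxdot_entry !mxdot_delta_self; lra.
Qed.

Lemma op_bounded_tr m n (Z : 'M[R]_(m, n)) s :
  op_bounded Z s -> op_bounded Z^T s.
Proof. by move=> hZ u v; rewrite mxdotC mxdot_mull trmxK [_ + _]addrC. Qed.

Lemma op_bounded_orthogonal m n (Z : 'M[R]_(m, n)) U V s :
  orthogonal_mx U -> orthogonal_mx V ->
  op_bounded Z s -> op_bounded (U *m Z *m V^T) s.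
Proof.
move=> /orthogonal_mx_tr hU /orthogonal_mx_tr hV hZ u v.
rewrite -!mulmxA mxdotC mxdot_mull mxdotC.
by rewrite -(mxdot_orthogonal u u hU) -(mxdot_orthogonal v v hV).
Qed.

Lemma op_bounded_drsubmx m1 m2 n1 n2 (Z : 'M[R]_(m1 + m2, n1 + n2)) s :
  op_bounded Z s -> op_bounded (drsubmx Z) s.
Proof.
move=> hZ u v; have := hZ (col_mx 0 u) (col_mx 0 v).
rewrite -{1}[Z]submxK mul_block_col !mulmx0 !add0r !mxdot_col_mx.
by rewrite !mxdot0l !add0r.
Qed.

(** A first-order variation: moving from e_j to e_j + t e_k changes the form by a term linear in t,
    while the bound only leaves room for a term in t^2. *)
Lemma op_bounded_attained m n (Z : 'M[R]_(m, n)) s i j k :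
  op_bounded Z s -> Z i j = s -> k != j -> Z i k = 0.
Proof.
move=> hZ Zij kj.
have kj0 : mxdot (delta_mx k 0 : 'cV[R]_n) (delta_mx j 0) = 0.
  by rewrite mxdot_delta mxE (negbTE kj).
have h t : 2 * t * Z i k <= s * t ^+ 2.
  have := hZ (delta_mx i 0) (delta_mx j 0 + t *: delta_mx k 0).
  rewrite mulmxDr -scalemxAr !(mxdotDr, mxdotDl, mxdotZr, mxdotZl).
  rewrite !mxdot_entry !mxdot_delta_self Zij kj0 mxdotC kj0; nra.
have s0 : 0 <= s.
  have := hZ (delta_mx i 0) (- delta_mx j 0).
  rewrite mulmxN !(mxdotNr, mxdotNl) mxdot_entry !mxdot_delta_self Zij; lra.
have /eqP : (Z i k) ^+ 2 = 0.
  apply/eqP; rewrite eq_le sqr_ge0 andbT.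
  (* A multiple of [Z i k] small enough for the linear term to win; the denominator s + 1 stays
     positive when s = 0. *)
  have := h (Z i k / (s + 1)).
  have -> : 2 * (Z i k / (s + 1)) * Z i k = 2 * (Z i k) ^+ 2 / (s + 1).
    by field; lra.
  have -> : s * (Z i k / (s + 1)) ^+ 2 = (s / (s + 1)) * (Z i k ^+ 2) / (s + 1).
    by field; lra.
  rewrite ler_pM2r ?invr_gt0; last lra.
  have : s / (s + 1) <= 1 by rewrite ler_pdivrMr; lra.
  have := sqr_ge0 (Z i k); nra.
by rewrite sqrf_eq0 => /eqP.
Qed.

(** An entry that attains the bound is alone in its row, and by transposition alone in its
    column. *)
Lemma op_bounded_block m n (Z : 'M[R]_(1 + m, 1 + n)) s :
  op_bounded Z s -> Z 0 0 = s -> Z = block_mx s%:M 0 0 (drsubmx Z).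
Proof.
move=> hZ Z00; rewrite -[LHS]submxK; congr block_mx.
- by rewrite [LHS]mx11_scalar !mxE !lshift0 Z00.
- apply/matrixP => i j; rewrite !mxE ord1 lshift0.
  by apply: op_bounded_attained hZ Z00 _.
- apply/matrixP => i j; rewrite !mxE ord1 lshift0.
  have := op_bounded_attained (op_bounded_tr hZ) (i := 0) (j := 0).
  by move=> /(_ (rshift 1 i)); rewrite !mxE; apply.
Qed.

(** Only the diagonal entries of [Z] count, and each is at most s. Peeling off the corner reduces to
    [drsubmx Z], which obeys the same bound. *)
Lemma mxdot_rect_diag_le m n (Z : 'M[R]_(m, n)) s (a : seq R) :
  op_bounded Z s -> all (>= 0) a -> size a = minn m n ->
  mxdot (rect_diag m n a) Z <= s * \sum_(x <- a) x.
Proof.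
elim: a m n Z => [|x a IH] m n Z hZ.
  by move=> _ _; rewrite rect_diag_nil mxdot0l big_nil mulr0.
case: m n Z hZ => [|m] [|n] // Z hZ /= /andP[x0 a0]; rewrite minnSS => -[sz].
have Z00 := op_bounded_entry 0 0 hZ.
pose Z' : 'M_(1 + m, 1 + n) := Z.
have := IH _ _ _ (op_bounded_drsubmx (hZ : op_bounded Z' s)) a0 sz.
have -> : mxdot (rect_diag m.+1 n.+1 (x :: a)) Z =
    x * Z 0 0 + mxdot (rect_diag m n a) (drsubmx Z').
  rewrite -[LHS]/(mxdot (rect_diag (1 + m) (1 + n) _) Z') rect_diag_cons.
  rewrite -[in LHS](submxK Z') mxdot_block !mxdot0l addr0 add0r.
  by rewrite mxdotE !big_ord1 !mxE !lshift0.
rewrite big_cons; nra.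
Qed.

Lemma op_bounded_rect_diag m n (s : R) (b : seq R) :
  0 <= s -> all (>= 0) b -> all (<= s) b -> op_bounded (rect_diag m n b) s.
Proof.
move=> s0; elim: b m n => [|x b IH] m n.
  move=> _ _ u v; rewrite rect_diag_nil mul0mx mxdotC mxdot0l mulr0.
  by rewrite mulr_ge0 ?addr_ge0 ?mxdot_ge0.
move=> /= /andP[x0 b0] /andP[xs bs].
have [mn0|] := eqVneq (minn m n) 0%N.
  move=> u v; rewrite [rect_diag _ _ _]flat_mx0 // mul0mx mxdotC mxdot0l mulr0.
  by rewrite mulr_ge0 ?addr_ge0 ?mxdot_ge0.
case: m n => [|m] [|n] // _ u v.
pose D : 'M_(1 + m, 1 + n) := rect_diag m.+1 n.+1 (x :: b).
pose u' : 'cV_(1 + m) := u; pose v' : 'cV_(1 + n) := v.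
rewrite -[X in X <= _]/(2 * mxdot u' (D *m v')).
rewrite -[X in _ <= X]/(s * (mxdot u' u' + mxdot v' v')).
rewrite /D rect_diag_cons -[u']vsubmxK -[v']vsubmxK.
move: (usubmx _) (dsubmx _) (usubmx _) (dsubmx _) => v1 v2 u1 u2.
rewrite mul_block_col !mul0mx addr0 add0r mul_scalar_mx !mxdot_col_mx mxdotZr.
(* The form splits as x <u1, v1> plus that of the smaller diagonal; the first part is handled by
   Cauchy-Schwarz and x <= s. *)
have h2 := IH _ _ b0 bs u2 v2; have := ler_wpM2l x0 (mxdot_cauchy u1 v1).
have := ler_wpM2r (addr_ge0 (mxdot_ge0 u1) (mxdot_ge0 v1)) xs; nra.
Qed.

End BilinearBound.

(** * Existence of ordered singular value decompositions *)

Section SingularValueDecomposition.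
Variable R : realType.

(** The two vectors are coordinate selections of a single row w, the format in which the extreme
    value theorem is applied. With B = 1 and f = g this also covers squared norms. *)
Lemma continuous_mxdot_coord N p q (f : 'I_p -> 'I_N) (g : 'I_q -> 'I_N)
    (B : 'M[R]_(p, q)) :
  continuous (fun w : 'rV[R]_N =>
    mxdot (\col_i w 0 (f i)) (B *m \col_j w 0 (g j))).
Proof.
have -> : (fun w : 'rV[R]_N => mxdot (\col_i w 0 (f i)) (B *m \col_j w 0 (g j)))
    = fun w => \sum_i \sum_j (w 0 (f i) * (B i j * w 0 (g j))).
  apply/funext => w; rewrite mxdotE; apply: eq_bigr => i _.
  by rewrite big_ord1 !mxE mulr_sumr; apply: eq_bigr => j _; rewrite mxE.
apply: (continuous_big add_continuous) => i _.
apply: (continuous_big add_continuous) => j _ w.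
have coord k : {for w, continuous (fun x : 'rV[R]_N => x 0 k)}.
  exact: coord_continuous.
by apply: (continuousM (coord (f i)) (continuousM (cvg_cst _) (coord (g j)))).
Qed.

(** The pair maximises <u, A v> over the product of the two unit spheres, which is compact;
    homogeneity extends the bound to all vectors. *)
Lemma top_singular_pair m n (A : 'M[R]_(m.+1, n.+1)) :
  exists (u : 'cV_m.+1) (v : 'cV_n.+1),
    [/\ mxdot u u = 1, mxdot v v = 1, 0 <= mxdot u (A *m v) &
        op_bounded A (mxdot u (A *m v))].
Proof.
pose N := (m.+1 + n.+1)%N.
(* A row of length N encodes the pair (u, v): [l] and [r] decode it, [join] encodes it. *)
pose l (w : 'rV[R]_N) : 'cV_m.+1 := \col_i w 0 (lshift n.+1 i).
pose r (w : 'rV[R]_N) : 'cV_n.+1 := \col_j w 0 (rshift m.+1 j).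
pose join (u : 'cV[R]_m.+1) (v : 'cV[R]_n.+1) : 'rV_N := row_mx u^T v^T.
have lj u v : l (join u v) = u.
  by apply/colP => i; rewrite mxE row_mxEl mxE.
have rj u v : r (join u v) = v.
  by apply/colP => i; rewrite mxE row_mxEr mxE.
pose K : set 'rV[R]_N :=
  [set w | mxdot (l w) (l w) = 1 /\ mxdot (r w) (r w) = 1]%classic.
have K0 : (K !=set0)%classic.
  exists (join (delta_mx 0 0) (delta_mx 0 0)).
  by rewrite /K /= lj rj !mxdot_delta_self.
have Kclosed : closed K.
  have cl (f : 'rV[R]_N -> R) : continuous f -> closed (f @^-1` [set 1])%classic.
    by move=> cf; apply: preimage_closed => [w _|]; [exact: cf | exact: closed_eq].
  have -> : K = ((fun w => mxdot (l w) (1%:M *m l w)) @^-1` [set 1] `&`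
                 (fun w => mxdot (r w) (1%:M *m r w)) @^-1` [set 1])%classic.
    by apply/funext => w; rewrite /K /= /setI /preimage /= !mul1mx.
  by apply: closedI; apply: cl; exact: continuous_mxdot_coord.
have entry_le1 p (x : 'cV[R]_p) i : mxdot x x = 1 -> `|x i 0| <= 1.
  move=> x1; rewrite -[leRHS]normr1 -ler_sqr ?nnegrE // !real_normK ?num_real //.
  rewrite expr1n -x1 mxdotE (bigD1 i) //= big_ord1 -expr2 lerDl.
  by apply: sumr_ge0 => j _; rewrite big_ord1 -expr2 sqr_ge0.
have Kbounded : bounded_set K.
  exists 1; split => // b b1 w [lw rw] /=.
  rewrite [leLHS]/Num.norm /= mx_normrE; apply/bigmax_leP; split=> [|[i j] _ /=].
    by lra.
  apply: le_trans (ltW b1); rewrite ord1.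
  case: (split_ordP j) => k ->.
  - by have := entry_le1 _ _ k lw; rewrite mxE.
  - by have := entry_le1 _ _ k rw; rewrite mxE.
have cf : {within K, continuous (fun w => mxdot (l w) (A *m r w))}%classic.
  by apply: continuous_subspaceT; exact: continuous_mxdot_coord.
have [w /set_mem [lw rw] wmax] :=
  EVT_max_rV K0 (bounded_closed_compact Kbounded Kclosed) cf.
exists (l w), (r w); set s := mxdot (l w) _ in wmax *.
have {}wmax (u : 'cV_m.+1) (v : 'cV_n.+1) :
    mxdot u u = 1 -> mxdot v v = 1 -> mxdot u (A *m v) <= s.
  move=> u1 v1; have := wmax (join u v); rewrite lj rj; apply.
  by apply/mem_set; rewrite /K /= lj rj.
(* Replacing u by -u negates the form, so its maximum is nonnegative. *)
have s0 : 0 <= s.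
  have := wmax (- l w) (r w); rewrite !mxdotNl !mxdotNr opprK lw rw -/s.
  by move=> /(_ erefl erefl); lra.
split=> // u v.
have [->|u0] := eqVneq u 0.
  by rewrite mxdot0l mulr0 mulr_ge0 // addr_ge0 ?mxdot_ge0 // mxdot0l.
have [->|v0] := eqVneq v 0.
  by rewrite mulmx0 mxdotC mxdot0l mulr0 mulr_ge0 // addr_ge0 ?mxdot_ge0.
have unit p (x : 'cV[R]_p) : x != 0 ->
    exists2 c, 0 < c & exists2 y, mxdot y y = 1 & x = c *: y.
  rewrite -mxdot_gt0 => x0; have c0 : 0 < Num.sqrt (mxdot x x) by rewrite sqrtr_gt0.
  exists (Num.sqrt (mxdot x x)) => //; exists ((Num.sqrt (mxdot x x))^-1 *: x).
    rewrite mxdotZl mxdotZr -{3}(sqr_sqrtr (ltW x0)); field; exact: lt0r_neq0.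
  by rewrite scalerA divff ?scale1r ?lt0r_neq0.
have [a a0 [x x1 ->]] := unit _ _ u0; have [b b0 [y y1 ->]] := unit _ _ v0.
rewrite -scalemxAr !(mxdotZl, mxdotZr) x1 y1.
(* With a and b the lengths of the vectors, 2 a b <x, A y> <= 2 a b s <= s (a^2 + b^2). *)
have := ler_wpM2l (mulr_ge0 (ltW a0) (ltW b0)) (wmax _ _ x1 y1).
have := mulr_ge0 s0 (sqr_ge0 (a - b)); nra.
Qed.

(** The diagonal [b] is kept free of [singular_values], so that decompositions can be built by
    blocks first; [singular_values_unique] identifies [b] afterwards. *)
Definition is_svd m n (A : 'M[R]_(m, n)) U b V : Prop :=
  [/\ orthogonal_mx U, orthogonal_mx V, size b = minn m n,
      sorted >=%R b /\ all (>= 0) b & A = U *m rect_diag m n b *m V^T].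

Lemma mul_block_orthogonal m n x (U : 'M[R]_m) (A : 'M_(m, n)) (V : 'M_n) :
  block_mx 1%:M 0 0 U *m block_mx x%:M 0 0 A *m (block_mx 1%:M 0 0 V)^T =
  block_mx x%:M 0 0 (U *m A *m V^T) :> 'M_(1 + m, 1 + n).
Proof.
rewrite tr_block_mx !trmx0 trmx1 !mulmx_block !mulmx0 !mul0mx.
by rewrite !addr0 !add0r mulmx1 mul1mx !mul0mx.
Qed.

Lemma is_svd_block m n s (A : 'M[R]_(m, n)) U b V :
  0 <= s -> path >=%R s b -> is_svd A U b V ->
  is_svd (block_mx s%:M 0 0 A : 'M_(1 + m, 1 + n))
    (block_mx 1%:M 0 0 U) (s :: b) (block_mx 1%:M 0 0 V).
Proof.
move=> s0 sb [hU hV sz [_ b0] ->]; split=> //=; rewrite ?s0 ?sz ?minnSS //.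
- exact: orthogonal_mx_block.
- exact: orthogonal_mx_block.
- by rewrite rect_diag_cons mul_block_orthogonal.
Qed.

Lemma is_svd_orthogonal m n (A : 'M[R]_(m, n)) P U b V Q :
  orthogonal_mx P -> orthogonal_mx Q -> is_svd A U b V ->
  is_svd (P *m A *m Q^T) (P *m U) b (Q *m V).
Proof.
move=> hP hQ [hU hV sz sb ->]; split=> //; [exact: orthogonal_mxM.. |].
by rewrite trmx_mul !mulmxA.
Qed.

(** In orthonormal bases starting with a top singular pair, the corner entry attains the bound and
    splits off; induction treats the remaining block. The bound s is part of the statement so that
    the new head dominates the tail. *)
Lemma is_svd_exists m n (A : 'M[R]_(m, n)) s :
  0 <= s -> op_bounded A s ->
  exists U b V, is_svd A U b V /\ path >=%R s b.
Proof.
elim: m n A s => [|m IH] n A s s0 hA.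
  exists 1%:M, [::], 1%:M; split=> //; split=> //; try exact: orthogonal_mx1.
  - by rewrite min0n.
  - by rewrite [LHS]flat_mx0 ?[RHS]flat_mx0 ?min0n.
case: n A hA => [|n] A hA.
  exists 1%:M, [::], 1%:M; split=> //; split=> //; try exact: orthogonal_mx1.
  by rewrite [LHS]flat_mx0 ?[RHS]flat_mx0 ?minn0.
have [u [v [u1 v1 t0 ht]]] := top_singular_pair A.
set t := mxdot u (A *m v) in t0 ht.
have [P hP Pu] := orthogonal_mx_complete u1.
have [Q hQ Qv] := orthogonal_mx_complete v1.
pose B : 'M[R]_(1 + m, 1 + n) := P^T *m A *m Q.
have hB : op_bounded B t.
  rewrite /B -[Q]trmxK.
  by apply: op_bounded_orthogonal => //; exact: orthogonal_mx_tr.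
have B00 : B 0 0 = t.
  rewrite -[LHS](mxdot_entry (B : 'M_(m.+1, n.+1))) /B -!mulmxA -colE Qv.
  by rewrite mxdotC mxdot_mull trmxK -colE Pu mxdotC.
have [U [b [V [svdB tb]]]] := IH _ _ _ t0 (op_bounded_drsubmx hB).
have AE : A = P *m B *m Q^T.
  rewrite /B !mulmxA (orthogonal_mx_trK hP) mul1mx -mulmxA.
  by rewrite (orthogonal_mx_trK hQ) mulmx1.
have := is_svd_block t0 tb svdB; rewrite -(op_bounded_block hB B00) => svd1.
have := is_svd_orthogonal hP hQ svd1; rewrite -AE => svd2.
eexists; exists (t :: b); eexists; split; first exact: svd2.
rewrite /= tb andbT.
(* The bound s, tested on the unit vectors u and v, gives t <= s. *)
have := hA u v; rewrite u1 v1 -/t; lra.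
Qed.

(** Equality forces the diagonal entries of [Z] facing positive entries of [a] to equal s, so they
    split off as 1x1 blocks. The factors [U] and [V] act as the identity there and are arbitrary
    only where [a] vanishes, hence they preserve [rect_diag m n a]. *)
Lemma is_svd_aligned m n (a : seq R) (Z : 'M[R]_(m, n)) s :
  0 <= s -> op_bounded Z s -> size a = minn m n ->
  sorted >=%R a -> all (>= 0) a ->
  mxdot (rect_diag m n a) Z = s * \sum_(x <- a) x ->
  exists U b V,
    [/\ is_svd Z U b V, path >=%R s b,
        U *m rect_diag m n a *m V^T = rect_diag m n a &
        forall i, a`_i * (s - b`_i) = 0].
Proof.
move=> s0; elim: a m n Z => [|x a IH] m n Z hZ sz.
  move=> _ _ _; have [U [b [V [svdZ sb]]]] := is_svd_exists s0 hZ.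
  exists U, b, V; split=> // [|i]; first by rewrite rect_diag_nil mulmx0 mul0mx.
  by rewrite nth_nil mul0r.
move=> xa /= /andP[x0 a0].
(* Since [a] is nonincreasing and nonnegative, a zero head makes it vanish entirely, and any ordered
   decomposition of [Z] will do. *)
have [xeq0 _|xneq0] := eqVneq x 0.
  have {}xa : forall i, (x :: a)`_i = 0.
    move=> i; have [ile|?] := ltnP i (size (x :: a)); last by rewrite nth_default.
    apply/eqP; rewrite eq_le.
    have := mem_nth 0 ile; rewrite inE => /orP[/eqP->|hin].
      by rewrite xeq0 lexx.
    rewrite (allP a0 _ hin) andbT.
    by apply: le_trans (allP (order_path_min ge_trans xa) _ hin) _; rewrite xeq0.
  have [U [b [V [svdZ sb]]]] := is_svd_exists s0 hZ.
  exists U, b, V; split=> // [|i]; last by rewrite xa mul0r.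
  have -> : rect_diag m n (x :: a) = 0.
    by apply/matrixP => i j; rewrite !mxE xa mul0rn.
  by rewrite mulmx0 mul0mx.
have {}x0 : 0 < x by rewrite lt0r xneq0.
case: m n Z hZ sz => [|m] [|n] // Z; rewrite minnSS => hZ0 [sz].
pose Z' : 'M_(1 + m, 1 + n) := Z.
have hZ : op_bounded Z' s := hZ0.
have -> : mxdot (rect_diag m.+1 n.+1 (x :: a)) Z =
    x * Z' 0 0 + mxdot (rect_diag m n a) (drsubmx Z').
  rewrite -[LHS]/(mxdot (rect_diag (1 + m) (1 + n) _) Z') rect_diag_cons.
  rewrite -[in LHS](submxK Z') mxdot_block !mxdot0l addr0 add0r.
  by rewrite mxdotE !big_ord1 !mxE !lshift0.
rewrite big_cons => eqZ.
have hle := mxdot_rect_diag_le (op_bounded_drsubmx hZ) a0 sz.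
have hle0 := ler_wpM2l (ltW x0) (op_bounded_entry 0 0 hZ).
(* The corner and the remaining block each obey their own bound, so equality of the sums makes both
   tight; x is then cancelled. *)
have Z00 : Z' 0 0 = s by apply: (mulfI xneq0); lra.
have [|U [b [V [svdZ sb Ua ab]]]] :=
  IH _ _ _ (op_bounded_drsubmx hZ) sz (path_sorted xa) a0; first lra.
have := is_svd_block s0 sb svdZ; rewrite -(op_bounded_block hZ Z00) => svd1.
eexists; exists (s :: b); eexists; split; first exact: svd1.
- by rewrite /= lexx.
- by rewrite (rect_diag_cons m n) mul_block_orthogonal Ua.
- by case=> [|i] /=; [rewrite subrr mulr0 | exact: ab].
Qed.

End SingularValueDecomposition.

(** * Agreement of decompositions with [singular_values] *)

Section SingularValuesUniqueness.
Variable R : realType.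

Lemma char_poly_orthogonal n (V D : 'M[R]_n) :
  orthogonal_mx V -> char_poly (V *m D *m V^T) = char_poly D.
Proof.
move=> hV; pose W := map_mx polyC V.
have WWT : W *m W^T = 1%:M.
  by rewrite /W matrix.map_trmx -map_mxM (orthogonal_mx_trK hV) map_mx1.
rewrite /char_poly /char_poly_mx !map_mxM -matrix.map_trmx -/W.
have -> : 'X%:M - W *m map_mx polyC D *m W^T =
          W *m ('X%:M - map_mx polyC D) *m W^T.
  rewrite mulmxBr mulmxBl; congr (_ - _).
  by rewrite mul_mx_scalar -scalemxAl WWT scalemx1.
by rewrite !det_mulmx mulrAC -det_mulmx WWT det1 mul1r.
Qed.

(** The multiplicity of a root x is its number of occurrences in [s], so both lists are permutations
    of each other, and both are sorted. *)
Lemma eigenvalues_prod_XsubC n (A : 'M[R]_n) (s : seq R) :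
  sorted >=%R s -> char_poly A = \prod_(x <- s) ('X - x%:P) ->
  eigenvalues A = s.
Proof.
move=> s_sorted Ap; rewrite /eigenvalues Ap.
set p := \prod_(x <- s) _.
have p0 : p != 0 by rewrite monic_neq0 // monic_prod_XsubC.
have roots_s : perm_eq (rootsR p) (undup s).
  apply: uniq_perm; [exact: uniq_roots | exact: undup_uniq |] => x.
  by have <- := roots_on_rootsR p0 x; rewrite mem_undup -root_prod_XsubC in_itv.
rewrite -[RHS](sorted_sort ge_trans s_sorted).
apply/(perm_sortP ge_total ge_trans ge_anti).
apply: perm_trans (perm_count_undup s); apply: perm_flatten.
rewrite (eq_map (g := fun x => nseq (count_mem x s) x)); first exact: perm_map.
by move=> x; rewrite /p mu_prod_XsubC.
Qed.

(** A^T A is orthogonally similar to a diagonal matrix with the squares of [b] on its diagonal,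
    which determines its characteristic polynomial. *)
Lemma singular_values_unique m n (A : 'M[R]_(m, n)) U b V :
  is_svd A U b V -> singular_values A = b.
Proof.
move=> [hU hV sz [b_sorted b0] AE].
have b_ge0 i : 0 <= b`_i.
  have [ib|ib] := ltnP i (size b); last by rewrite nth_default.
  exact: (allP b0 _ (mem_nth 0 ib)).
have b_homo i j : (i <= j)%N -> b`_j <= b`_i.
  move=> ij; have [jb|jb] := ltnP j (size b); last by rewrite nth_default.
  apply: (sorted_leq_nth ge_trans ge_refl 0 b_sorted) => //.
  by rewrite inE (leq_ltn_trans ij).
pose D := (rect_diag m n b)^T *m rect_diag m n b.
have DE i j : D i j = (b`_i ^+ 2) *+ (i == j).
  rewrite mxE; have [im|mi] := ltnP i m.
    rewrite (bigD1 (Ordinal im)) //= big1 => [|k ki]; last first.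
      rewrite !mxE; suff -> : (k == i :> nat) = false by rewrite mulr0n mul0r.
      by apply: contraNF ki => /eqP ki; apply/eqP/val_inj.
    rewrite !mxE /= eqxx addr0 -(inj_eq val_inj) /=.
    by case: eqP => [->|_]; rewrite ?mulr0n ?mulr0.
  rewrite big1 => [|k _].
    by rewrite nth_default ?expr0n ?mul0rn // sz (leq_trans _ mi) // geq_minl.
  rewrite !mxE; suff -> : (k == i :> nat) = false by rewrite mulr0n mul0r.
  by apply/negbTE; rewrite neq_ltn (leq_trans (ltn_ord k) mi).
have ATA : A^T *m A = V *m D *m V^T.
  rewrite AE !trmx_mul trmxK -!mulmxA; congr (_ *m _).
  by rewrite /D (mulmxA U^T) hU mul1mx !mulmxA.
rewrite /singular_values.
have -> : eigenvalues (A^T *m A) = [seq b`_i ^+ 2 | i <- iota 0 n].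
  apply: eigenvalues_prod_XsubC.
    apply: (homo_sorted (e := leq)); last exact: iota_sorted.
    by move=> i j ij; rewrite /= ler_sqr ?nnegrE ?b_homo.
  rewrite ATA char_poly_orthogonal // char_poly_trig; last first.
    by apply/is_trig_mxP => i j ij; rewrite DE -(inj_eq val_inj) ltn_eqF.
  rewrite big_map -[n in iota 0 n]subn0 big_mkord.
  by apply: eq_bigr => i _; rewrite DE eqxx.
rewrite -map_comp (eq_map (g := nth 0 b)); last first.
  by move=> i /=; rewrite sqrtr_sqr ger0_norm.
apply: (@eq_from_nth _ 0) => [|i].
  rewrite size_take size_map size_iota sz.
  by case: (ltnP (minn m n)) => // nm; apply/eqP; rewrite eqn_leq nm geq_minr.
rewrite size_take size_map size_iota => ilt.
have im : (i < minn m n)%N.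
  by move: ilt; case: (ltnP (minn m n)) => // nm /leq_trans; apply.
have in_ := leq_trans im (geq_minr m n).
by rewrite nth_take // (nth_map 0%N) ?size_iota // nth_iota.
Qed.

Lemma singular_values_svd m n (A : 'M[R]_(m, n)) s :
  0 <= s -> op_bounded A s ->
  exists U V, is_svd A U (singular_values A) V /\
    path >=%R s (singular_values A).
Proof.
move=> s0 hA; have [U [b [V [svdA sb]]]] := is_svd_exists s0 hA.
by exists U, V; rewrite (singular_values_unique svdA).
Qed.

End SingularValuesUniqueness.

(** * The four norms and their duality *)

Section Norms.
Variables (R : realType) (m n : nat).
Implicit Types A X Y Z W : 'M[R]_(m, n).

Lemma op_bounded_ex A : exists2 s, 0 <= s & op_bounded A s.
Proof.
have [mn0|] := eqVneq (minn m n) 0%N.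
  exists 0 => // u v.
  by rewrite (flat_mx0 A mn0) mul0mx mxdotC mxdot0l mulr0 mul0r.
case: m n A => [|k] [|l] // A _.
by have [u [v [_ _ s0 hs]]] := top_singular_pair A; exists (mxdot u (A *m v)).
Qed.

Lemma singular_valuesP A : exists U V, is_svd A U (singular_values A) V.
Proof.
have [s s0 hs] := op_bounded_ex A.
by have [U [V [svdA _]]] := singular_values_svd s0 hs; exists U, V.
Qed.

Lemma singular_values_ge0 A : all (>= 0) (singular_values A).
Proof. by have [U [V [_ _ _ []]]] := singular_valuesP A. Qed.

Lemma size_singular_values A : size (singular_values A) = minn m n.
Proof. by have [U [V []]] := singular_valuesP A. Qed.

Lemma spectral_norm_ge0 A : 0 <= spectral_norm A.
Proof. by rewrite /spectral_norm; apply: bigmax_ge_id. Qed.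

Lemma op_bounded_spectral_norm A : op_bounded A (spectral_norm A).
Proof.
have [U [V [hU hV _ [_ b0] AE]]] := singular_valuesP A.
rewrite {1}AE; apply: op_bounded_orthogonal => //.
apply: op_bounded_rect_diag => //; first exact: spectral_norm_ge0.
by apply/allP => x xA; apply: le_bigmax_seq.
Qed.

(** With [op_bounded_spectral_norm], this makes the spectral norm the least nonnegative bound of the
    bilinear form. *)
Lemma spectral_norm_le A s : 0 <= s -> op_bounded A s -> spectral_norm A <= s.
Proof.
move=> s0 hA; have [U [V [_ sb]]] := singular_values_svd s0 hA.
rewrite /spectral_norm big_seq; apply: bigmax_le => // x.
exact: (allP (order_path_min ge_trans sb)).
Qed.

Lemma nuclear_norm_ge0 A : 0 <= nuclear_norm A.
Proof.
rewrite /nuclear_norm big_seq; apply: sumr_ge0 => x.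
exact: (allP (singular_values_ge0 A)).
Qed.

Lemma mxdot_svd A U b V W :
  is_svd A U b V -> mxdot A W = mxdot (rect_diag m n b) (U^T *m W *m V).
Proof.
by case=> _ _ _ _ ->; rewrite -mulmxA mxdot_mull mxdot_mulr trmxK.
Qed.

Lemma nuclear_norm_ge A W s :
  op_bounded W s -> mxdot A W <= s * nuclear_norm A.
Proof.
move=> hW; have [U [V svdA]] := singular_valuesP A.
rewrite (mxdot_svd W svdA); case: svdA => hU hV sz [_ b0] _.
apply: mxdot_rect_diag_le => //; rewrite -[V]trmxK.
by apply: op_bounded_orthogonal => //; exact: orthogonal_mx_tr.
Qed.

Lemma mxdot_rect_diag k l (a b : seq R) : size a = minn k l ->
  mxdot (rect_diag k l a) (rect_diag k l b) = \sum_(i < size a) a`_i * b`_i.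
Proof.
elim: a k l b => [|x a IH] k l b sz.
  by rewrite rect_diag_nil mxdot0l big_ord0.
case: b => [|y b].
  rewrite rect_diag_nil mxdotC mxdot0l big1 // => i _.
  by rewrite nth_nil mulr0.
case: k l sz => [|k] [|l] //; rewrite minnSS => -[sz].
rewrite -[LHS]/(mxdot (rect_diag (1 + k) (1 + l) _) _) !rect_diag_cons.
rewrite mxdot_block !mxdot0l addr0 add0r (IH _ _ _ sz) big_ord_recl /=.
by rewrite mxdotE !big_ord1 !mxE.
Qed.

(** The witness keeps the singular vectors of [A] and sets all singular values to 1. With
    [nuclear_norm_ge], the nuclear norm is thus a maximum of linear functionals, whence its
    sublinearity. *)
Lemma nuclear_norm_attained A :
  exists2 W, op_bounded W 1 & mxdot A W = nuclear_norm A.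
Proof.
have [U [V svdA]] := singular_valuesP A; have [hU hV sz _ _] := svdA.
pose D := rect_diag m n (nseq (minn m n) (1 : R)).
exists (U *m D *m V^T).
  apply: op_bounded_orthogonal => //; apply: op_bounded_rect_diag => //.
  - by rewrite all_nseq ler01 orbT.
  - by rewrite all_nseq /= lexx orbT.
rewrite (mxdot_svd _ svdA) !mulmxA hU mul1mx -mulmxA hV mulmx1.
rewrite /D mxdot_rect_diag // /nuclear_norm (big_nth 0) big_mkord.
by apply: eq_bigr => i _; rewrite nth_nseq -sz ltn_ord mulr1.
Qed.

Lemma nuclear_normD A B :
  nuclear_norm (A + B) <= nuclear_norm A + nuclear_norm B.
Proof.
have [W hW <-] := nuclear_norm_attained (A + B); rewrite mxdotDl.
by apply: lerD; rewrite -[leRHS]mul1r; exact: nuclear_norm_ge.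
Qed.

Lemma nuclear_normZ_le t A :
  0 <= t -> nuclear_norm (t *: A) <= t * nuclear_norm A.
Proof.
move=> t0; have [W hW <-] := nuclear_norm_attained (t *: A); rewrite mxdotZl.
by apply: ler_wpM2l => //; rewrite -[leRHS]mul1r; exact: nuclear_norm_ge.
Qed.

Lemma nuclear_norm0 : nuclear_norm (0 : 'M[R]_(m, n)) = 0.
Proof.
apply/eqP; rewrite eq_le nuclear_norm_ge0 andbT.
by have := nuclear_normZ_le 0 (lexx 0); rewrite scale0r mul0r; apply.
Qed.

(** Pairing [A] with itself bounds <A, A> > 0 by the spectral norm times the nuclear norm. *)
Lemma nuclear_norm_gt0 A : A != 0 -> 0 < nuclear_norm A.
Proof.
rewrite -mxdot_gt0.
move=> /lt_le_trans /(_ (nuclear_norm_ge A (op_bounded_spectral_norm A))).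
by apply: contraLR; rewrite -!leNgt => A0; rewrite mulr_ge0_le0 ?spectral_norm_ge0.
Qed.

Lemma nuclear_norm_rank1 (u : 'cV[R]_m) (v : 'cV[R]_n) :
  2 * nuclear_norm (u *m v^T) <= mxdot u u + mxdot v v.
Proof.
have [W hW <-] := nuclear_norm_attained (u *m v^T).
by rewrite mxdot_mulr trmxK -[leRHS]mul1r.
Qed.

Lemma entry_norm1_ge0 A : 0 <= entry_norm1 A.
Proof. by do 2!apply: sumr_ge0 => ? _. Qed.

Lemma entry_norm10 : entry_norm1 (0 : 'M[R]_(m, n)) = 0.
Proof. by do 2!apply: big1 => ? _; rewrite mxE normr0. Qed.

Lemma entry_norm1D A B : entry_norm1 (A + B) <= entry_norm1 A + entry_norm1 B.
Proof.
rewrite -big_split; apply: ler_sum => i _; rewrite -big_split.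
by apply: ler_sum => j _; rewrite mxE ler_normD.
Qed.

Lemma entry_norm1Z t A : entry_norm1 (t *: A) = `|t| * entry_norm1 A.
Proof.
rewrite mulr_sumr; apply: eq_bigr => i _; rewrite mulr_sumr.
by apply: eq_bigr => j _; rewrite mxE normrM.
Qed.

Lemma entry_norm1_delta i j : entry_norm1 (delta_mx i j : 'M[R]_(m, n)) = 1.
Proof.
rewrite /entry_norm1 (bigD1 i) //= (bigD1 j) //= mxE !eqxx normr1.
rewrite big1 => [|l /negbTE nl]; last by rewrite mxE nl andbF normr0.
rewrite big1 ?addr0 // => k /negbTE nk.
by rewrite big1 // => l _; rewrite mxE nk normr0.
Qed.

Lemma le_entry_norm_oo A i j : `|A i j| <= entry_norm_oo A.
Proof.
rewrite /entry_norm_oo mx_normrE.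
exact: (le_bigmax _ (fun ij : 'I_m * 'I_n => `|A ij.1 ij.2|) (i, j)).
Qed.

Lemma entry_norm_oo_le A c :
  0 <= c -> (forall i j, `|A i j| <= c) -> entry_norm_oo A <= c.
Proof.
by move=> c0 hc; rewrite /entry_norm_oo mx_normrE; apply: bigmax_le.
Qed.

Lemma mxdot_le_entry_norm Y Z : mxdot Y Z <= entry_norm1 Y * entry_norm_oo Z.
Proof.
rewrite mxdotE mulr_suml; apply: ler_sum => i _; rewrite mulr_suml.
apply: ler_sum => j _; apply: le_trans (ler_norm _) _; rewrite normrM.
by apply: ler_wpM2l => //; exact: le_entry_norm_oo.
Qed.

Lemma entry_norm1_gt0 A : A != 0 -> 0 < entry_norm1 A.
Proof.
rewrite -mxdot_gt0 => /lt_le_trans /(_ (mxdot_le_entry_norm A A)).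
move=> A0; rewrite lt0r entry_norm1_ge0 andbT.
by apply: contraTneq A0 => ->; rewrite mul0r ltxx.
Qed.

End Norms.

(** * A finite-dimensional Hahn-Banach theorem *)

Section HahnBanach.
Variable R : realType.

Definition sublinear (V : lmodType R) (q : V -> R) : Prop :=
  (forall u v, q (u + v) <= q u + q v) /\
  (forall t v, 0 <= t -> q (t *: v) = t * q v).

Lemma sublinear0 (V : lmodType R) (q : V -> R) : sublinear q -> q 0 = 0.
Proof. by move=> [_ qZ]; rewrite -(scale0r 0) qZ // mul0r. Qed.

Lemma sublinear_opp_ge (V : lmodType R) (q : V -> R) v :
  sublinear q -> - q v <= q (- v).
Proof.
by move=> hq; have := hq.1 v (- v); rewrite subrr (sublinear0 hq); lra.
Qed.

(** Serves both the construction of smaller sublinear functionals and the value function of (P).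
    Homogeneity needs one inequality only: the other is the same at the factor t^-1. *)
Lemma sublinear_inf (V : lmodType R) (G : V -> R -> Prop) :
  (forall v, exists r, G v r) ->
  (forall v, exists c, forall r, G v r -> c <= r) ->
  (forall u v r s, G u r -> G v s -> G (u + v) (r + s)) ->
  (forall t v r, 0 < t -> G v r -> G (t *: v) (t * r)) ->
  sublinear (fun v => inf (G v)).
Proof.
move=> G_ne G_lb GD GZ.
have infle v r : G v r -> inf (G v) <= r.
  by move=> Gr; apply: ge_inf => //; have [c hc] := G_lb v; exists c => ? /hc.
have leinf v c : (forall r, G v r -> c <= r) -> c <= inf (G v).
  by move=> hc; apply: lb_le_inf => //; exact: G_ne.
have scale_le t v : 0 < t -> inf (G (t *: v)) <= t * inf (G v).
  move=> t0; rewrite mulrC -ler_pdivrMr //; apply: leinf => r Gr.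
  by rewrite ler_pdivrMr // mulrC; apply: infle; exact: GZ.
have scale t v : 0 < t -> inf (G (t *: v)) = t * inf (G v).
  move=> t0; apply/eqP; rewrite eq_le scale_le //=.
  have := scale_le t^-1 (t *: v); rewrite invr_gt0 scalerA mulVf ?lt0r_neq0 //.
  by rewrite scale1r => /(_ t0); rewrite mulrC ler_pdivlMr // mulrC.
split=> [u v|t v].
  rewrite -lerBlDr; apply: (leinf) => r Gr; rewrite lerBlDr -lerBlDl.
  apply: (leinf) => s Gs; rewrite lerBlDl; apply: infle; exact: GD.
rewrite le0r => /orP[/eqP ->|]; last exact: scale.
by have := scale 2 0; rewrite ltr0n scaler0 scale0r mul0r => /(_ isT); lra.
Qed.

(** The functional q' v is the infimum over t >= 0 of q (v + t x) - t q x; the choice t = 0 gives q'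
    <= q, and t = 1 the bound at - x. *)
Lemma sublinear_odd_at (V : lmodType R) (q : V -> R) (x : V) :
  sublinear q ->
  exists q', [/\ sublinear q', forall v, q' v <= q v & q' (- x) <= - q x].
Proof.
move=> hq; have [qD qZ] := hq.
pose G v r := exists2 t, 0 <= t & q (v + t *: x) - t * q x <= r.
have G_lb v r : G v r -> - q (- v) <= r.
  move=> [t t0]; have := qD (v + t *: x) (- v).
  by rewrite addrC addKr qZ //; lra.
have infle v r : G v r -> inf (G v) <= r.
  by move=> Gr; apply: ge_inf => //; exists (- q (- v)) => ? /G_lb.
exists (fun v => inf (G v)); split.
- apply: sublinear_inf => [v|v|u v r s|t v r t0].
  + by exists (q (v + 0 *: x) - 0 * q x); exists 0.
  + by exists (- q (- v)) => r /G_lb.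
  + move=> [a a0 ar] [b b0 bs]; exists (a + b); first exact: addr_ge0.
    by have := qD (u + a *: x) (v + b *: x); rewrite addrACA -scalerDl; lra.
  + move=> [a a0 ar]; exists (t * a); first by rewrite mulr_ge0 // ltW.
    rewrite -scalerA -scalerDr (qZ _ _ (ltW t0)) -mulrA -mulrBr.
    by rewrite ler_wpM2l ?(ltW t0).
- by move=> v; apply: infle; exists 0 => //; rewrite scale0r addr0 mul0r subr0.
- apply: infle; exists 1 => //.
  by rewrite scale1r addNr (sublinear0 hq) mul1r sub0r.
Qed.

(** The points are treated one after another. Oddness at x survives in any smaller sublinear q2,
    since q2 (- x) <= q1 (- x) <= - q x <= - q2 x. *)
Lemma sublinear_odd_on (V : lmodType R) (xs : seq V) (q : V -> R) :
  sublinear q ->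
  exists q', [/\ sublinear q', forall v, q' v <= q v &
    {in xs, forall x, q' (- x) = - q' x}].
Proof.
elim: xs q => [|x xs IH] q hq; first by exists q.
have [q1 [hq1 le1 q1x]] := sublinear_odd_at x hq.
have [q2 [hq2 le2 odd2]] := IH q1 hq1.
exists q2; split=> // [v|y]; first exact: le_trans (le2 v) (le1 v).
rewrite inE => /orP[/eqP ->|]; last exact: odd2.
apply/eqP; rewrite eq_le sublinear_opp_ge // andbT.
have := le2 x; have := le2 (- x); have := le1 x; lra.
Qed.

Lemma sublinear_sum (V : lmodType R) (q : V -> R) (I : Type) (r : seq I) F :
  sublinear q -> q (\sum_(i <- r) F i) <= \sum_(i <- r) q (F i).
Proof.
move=> hq; elim/big_rec2: _ => [|i y z _ IH]; first by rewrite sublinear0.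
by apply: le_trans (hq.1 _ _) _; rewrite lerD2l.
Qed.

(** Once odd on the matrix units, a sublinear functional is linear, hence the pairing with some [Z].
    Lowering [q] at [M] beforehand makes the bound at [M] tight. *)
Lemma hahn_banach_mx m n (q : 'M[R]_(m, n) -> R) (M : 'M[R]_(m, n)) :
  sublinear q ->
  exists Z, q M <= mxdot M Z /\ forall N, mxdot N Z <= q N.
Proof.
move=> hq.
have [q1 [hq1 le1 q1M]] := sublinear_odd_at M hq.
pose xs := [seq (delta_mx ij.1 ij.2 : 'M[R]_(m, n)) | ij : 'I_m * 'I_n].
have [q2 [hq2 le2 odd2]] := sublinear_odd_on xs hq1.
have q2Z t i j : q2 (t *: delta_mx i j) = t * q2 (delta_mx i j).
  have [t0|t0] := lerP 0 t; first by rewrite hq2.2.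
  have := hq2.2 (- t) (- delta_mx i j); rewrite scalerN scaleNr opprK => ->.
    by rewrite odd2 ?mulrNN //; apply/mapP; exists (i, j); rewrite ?mem_enum.
  by rewrite oppr_ge0 ltW.
pose Z : 'M[R]_(m, n) := \matrix_(i, j) q2 (delta_mx i j).
have leZ N : q2 N <= mxdot N Z.
  rewrite [N in q2 N]matrix_sum_delta mxdotE.
  apply: le_trans (sublinear_sum _ _ hq2) _; apply: ler_sum => i _.
  apply: le_trans (sublinear_sum _ _ hq2) _; apply: ler_sum => j _.
  by rewrite q2Z mxE.
have geZ N : mxdot N Z <= q2 N.
  have := leZ (- N); have := sublinear_opp_ge N hq2; rewrite mxdotNl; lra.
exists Z; split=> [|N].
  (* The chain is - <M, Z> <= q2 (- M) <= q1 (- M) <= - q M. *)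
  have := geZ (- M); have := le2 (- M); rewrite mxdotNl; lra.
by apply: le_trans (geZ N) (le_trans (le2 N) (le1 N)).
Qed.


End HahnBanach.

(** * Weak duality, its equality case and dual certificates *)

Section Duality.
Variables (R : realType) (m n : nat) (gamma : R).
Hypothesis gamma_gt0 : 0 < gamma.
Implicit Types X Y Z M : 'M[R]_(m, n).

(** In singular bases of [X] the hypothesis becomes the equality case of [is_svd_aligned]; its
    factors, composed with those bases, decompose both matrices. *)
Lemma spectral_nuclear_equality X Z :
  mxdot X Z = spectral_norm Z * nuclear_norm X ->
  simultaneous_ordered_svd X Z /\
  forall i, (singular_values X)`_i *
    (spectral_norm Z - (singular_values Z)`_i) = 0.
Proof.
move=> eqXZ; have [U [V svdX]] := singular_valuesP X.
have := eqXZ; rewrite (mxdot_svd Z svdX).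
have [hU hV sz [a_sorted a0] XE] := svdX.
have hW : op_bounded (U^T *m Z *m V) (spectral_norm Z).
  rewrite -[V]trmxK; apply: op_bounded_orthogonal;
    [exact: orthogonal_mx_tr.. | exact: op_bounded_spectral_norm].
move=> eqW; have [U' [b [V' [svdW _ alignX comp]]]] :=
  is_svd_aligned (spectral_norm_ge0 Z) hW sz a_sorted a0 eqW.
have := is_svd_orthogonal hU hV svdW.
have -> : U *m (U^T *m Z *m V) *m V^T = Z.
  rewrite !mulmxA (orthogonal_mx_trK hU) mul1mx -mulmxA.
  by rewrite (orthogonal_mx_trK hV) mulmx1.
move=> svdZ; rewrite (singular_values_unique svdZ); split=> //.
have [hUU hVV _ _ ZE] := svdZ; exists (U *m U'), (V *m V'); split=> //.
  by rewrite trmx_mul !mulmxA -(mulmxA U U') -(mulmxA U (U' *m _)) alignX.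
by rewrite (singular_values_unique svdZ).
Qed.

Lemma mxdot_simultaneous_svd X Z : simultaneous_ordered_svd X Z ->
  mxdot X Z =
  \sum_(i < minn m n) (singular_values X)`_i * (singular_values Z)`_i.
Proof.
move=> [U [V [hU hV]]]; have := size_singular_values X.
move: (singular_values X) (singular_values Z) => a b sz -> ->.
rewrite mxdot_mulr trmxK -mulmxA hV mulmx1 mxdot_orthogonal //.
by rewrite mxdot_rect_diag sz.
Qed.

Definition primal_objective X Y := nuclear_norm X + gamma * entry_norm1 Y.

Definition dual_objective Z :=
  Num.max (spectral_norm Z) (entry_norm_oo Z / gamma).

Lemma primal_objective_gt0 X Y : X + Y != 0 -> 0 < primal_objective X Y.
Proof.
have := nuclear_norm_ge0 X; have := entry_norm1_ge0 Y; rewrite /primal_objective.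
have [->|/entry_norm1_gt0 Y0 _ X0 _] := eqVneq Y 0.
  by rewrite addr0 entry_norm10 mulr0 addr0 => _ _ /nuclear_norm_gt0.
by rewrite ltr_wpDl // mulr_gt0.
Qed.

Lemma entry_norm_oo_le_dual Z : entry_norm_oo Z <= dual_objective Z * gamma.
Proof. by rewrite -ler_pdivrMr // le_max lexx orbT. Qed.

Lemma weak_duality X Y Z :
  mxdot (X + Y) Z <= dual_objective Z * primal_objective X Y.
Proof.
rewrite mxdotDl /primal_objective.
have := nuclear_norm_ge X (op_bounded_spectral_norm Z).
have := mxdot_le_entry_norm Y Z.
have := ler_wpM2l (entry_norm1_ge0 Y) (entry_norm_oo_le_dual Z).
have : spectral_norm Z <= dual_objective Z by rewrite le_max lexx.
move/(ler_wpM2r (nuclear_norm_ge0 X)); nra.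
Qed.

Lemma dual_certificate M X Y : optimal_P M gamma X Y ->
  exists Z, [/\ primal_objective X Y <= mxdot M Z, op_bounded Z 1 &
                entry_norm_oo Z <= gamma].
Proof.
move=> [/= XYM optXY].
have obj_ge0 X' Y' : 0 <= primal_objective X' Y'.
  by rewrite addr_ge0 ?nuclear_norm_ge0 ?mulr_ge0 ?entry_norm1_ge0 ?ltW.
(* The infimum of [G N] is the optimal value of (P) with [N] in place of [M]. The bounds on [Z] come
   from testing its linear functional on the splittings (u v^T, 0) and (0, t E_ij). *)
pose G N r := exists X' Y' : 'M[R]_(m, n),
  X' + Y' = N /\ primal_objective X' Y' <= r.
have infle N r : G N r -> inf (G N) <= r.
  move=> Gr; apply: ge_inf => //; exists 0 => ? [X' [Y' [_]]].
  exact: le_trans.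
have hq : sublinear (fun N => inf (G N)).
  apply: sublinear_inf => [N|N|N N' r s|t N r t0].
  - by exists (primal_objective N 0), N, 0; rewrite addr0.
  - by exists 0 => r [X' [Y' [_]]]; exact: le_trans.
  - move=> [A [B [<- hr]]] [C [D [<- hs]]]; exists (A + C), (B + D).
    split; first by rewrite addrACA.
    apply: le_trans (lerD hr hs); rewrite /primal_objective.
    have := nuclear_normD A C; have := ler_wpM2l (ltW gamma_gt0) (entry_norm1D B D).
    lra.
  - move=> [A [B [<- hr]]]; exists (t *: A), (t *: B); rewrite scalerDr; split=> //.
    apply: le_trans (ler_wpM2l (ltW t0) hr); rewrite /primal_objective.
    rewrite entry_norm1Z gtr0_norm //.
    have := nuclear_normZ_le A (ltW t0); nra.
have [Z [MZ leZ]] := hahn_banach_mx M hq.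
exists Z; split.
- apply: le_trans MZ; apply: lb_le_inf.
    by exists (primal_objective X Y), X, Y.
  by move=> r [A [B [AB]]]; apply: le_trans; exact: (optXY (A, B)).
- move=> u v; rewrite mul1r.
  apply: le_trans (nuclear_norm_rank1 u v).
  rewrite ler_pM2l // -[in leLHS](trmxK v) -mxdot_mulr.
  apply: le_trans (leZ _) _; apply: infle; exists (u *m v^T), 0.
  by rewrite addr0 /primal_objective entry_norm10 mulr0 addr0.
- apply: entry_norm_oo_le => [|i j]; first exact: ltW.
  (* Both signs t = 1 and t = -1 are used, to bound the absolute value. *)
  have h t : `|t| = 1 -> t * Z i j <= gamma.
    move=> t1; rewrite -mxdot_delta -mxdotZl.
    apply: le_trans (leZ _) _; apply: infle; exists 0, (t *: delta_mx i j).
    rewrite add0r /primal_objective nuclear_norm0 entry_norm1Z t1.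
    by rewrite entry_norm1_delta !mulr1 add0r.
  rewrite ler_norml; have := h 1 (normr1 _); have := h (-1) (normrN1 _); lra.
Qed.

End Duality.

Theorem theorem3p4 (R : realType) (m n : nat) (M : 'M[R]_(m, n)) (gamma : R)
    (gamma_gt0 : 0 < gamma) (M_neq0 : M <> 0) (X Y Z : 'M[R]_(m, n)) :
  (optimality_conditions M gamma X Y Z ->
     optimal_P M gamma X Y /\ optimal_D M gamma Z) /\
  (optimal_P M gamma X Y -> optimal_D M gamma Z -> X <> 0 -> Y <> 0 ->
     optimality_conditions M gamma X Y Z).
Proof.
split.
  move=> [XYM [MZ1 [YZ [comp [svdXZ normsZ]]]]].
  have XZ : mxdot X Z = spectral_norm Z * nuclear_norm X.
    rewrite mxdot_simultaneous_svd // /nuclear_norm (big_nth 0) big_mkord.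
    rewrite size_singular_values mulr_sumr; apply: eq_bigr => i _.
    by have := comp i; rewrite mulrBr => /eqP; rewrite subr_eq0 mulrC => /eqP <-.
  have dualZ : dual_objective gamma Z = spectral_norm Z.
    by rewrite /dual_objective -normsZ maxxx.
  have ooZ : entry_norm_oo Z = spectral_norm Z * gamma.
    by rewrite normsZ divfK // lt0r_neq0.
  (* Weak duality is tight here: the product of the two objectives is 1, and for any feasible pair
     it is at least 1. *)
  have pd : spectral_norm Z * primal_objective gamma X Y = 1.
    rewrite -MZ1 -XYM mxdotDl XZ -YZ ooZ /primal_objective; ring.
  have d0 : 0 < spectral_norm Z.
    rewrite lt0r spectral_norm_ge0 andbT; apply/eqP => d0.
    by move: pd; rewrite d0 mul0r => /esym/eqP; rewrite oner_eq0.
  split; split=> //=.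
  - move=> [X' Y'] /= XYM'; rewrite -(ler_pM2l d0).
    have := weak_duality gamma_gt0 X' Y' Z; rewrite XYM' MZ1 dualZ.
    by rewrite -pd.
  - by rewrite MZ1.
  - move=> Z' Z'1; rewrite -[X in X <= _]/(dual_objective gamma Z) dualZ.
    have p0 : 0 < primal_objective gamma X Y.
      by rewrite -(pmulr_rgt0 _ d0) pd.
    rewrite -(ler_pM2r p0) pd; apply: le_trans Z'1 _.
    by rewrite -XYM; exact: weak_duality.
move=> optP [/= feasZ optZ] /eqP X0 /eqP Y0; have [/= XYM _] := optP.
have [Z0 [pZ0 opZ0 ooZ0]] := dual_certificate gamma_gt0 optP.
set p := primal_objective gamma X Y in pZ0.
have p0 : 0 < p by apply: primal_objective_gt0; rewrite // XYM; apply/eqP.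
set d := dual_objective gamma Z.
(* The certificate divided by p is feasible for (D), with objective at most 1 / p. *)
have dp : d * p <= 1.
  rewrite -ler_pdivlMr // mul1r.
  apply: le_trans (optZ (p^-1 *: Z0) _) _.
    by rewrite mxdotZr mulrC ler_pdivlMr // mul1r.
  rewrite ge_max; apply/andP; split.
    apply: spectral_norm_le; first by rewrite invr_ge0 ltW.
    move=> u v; rewrite -scalemxAl mxdotZr mulrCA ler_pM2l ?invr_gt0 //.
    by rewrite -[leRHS]mul1r; exact: opZ0.
  rewrite ler_pdivrMr //; apply: entry_norm_oo_le => [|i j].
    by rewrite mulr_ge0 ?invr_ge0 ?ltW.
  rewrite mxE normrM gtr0_norm ?invr_gt0 // ler_pM2l ?invr_gt0 //.
  exact: le_trans (le_entry_norm_oo _ _ _) ooZ0.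
have N0 := nuclear_norm_gt0 X0; have E0 := entry_norm1_gt0 Y0.
have hX := nuclear_norm_ge X (op_bounded_spectral_norm Z).
have hY := mxdot_le_entry_norm Y Z.
have hE := ler_wpM2l (ltW E0) (entry_norm_oo_le_dual gamma_gt0 Z).
have hN : spectral_norm Z * nuclear_norm X <= d * nuclear_norm X.
  by rewrite ler_pM2r // le_max lexx.
have feas : 1 <= mxdot X Z + mxdot Y Z by rewrite -mxdotDl XYM.
(* With [feas], this squeezes [hX], [hN], [hY] and [hE] into equalities. *)
have sum : d * nuclear_norm X + entry_norm1 Y * (d * gamma) <= 1.
  by apply: le_trans dp; rewrite /p /primal_objective; lra.
rewrite -/d in hE.
(* Here X and Y being nonzero matters: their positive norms are cancelled, so both terms of the
   maximum equal d. *)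
have spZ : spectral_norm Z = d by apply: (mulIf (lt0r_neq0 N0)); lra.
have ooZ : entry_norm_oo Z = d * gamma by apply: (mulfI (lt0r_neq0 E0)); lra.
have [svdXZ comp] : simultaneous_ordered_svd X Z /\
    forall i, (singular_values X)`_i *
      (spectral_norm Z - (singular_values Z)`_i) = 0.
  by apply: spectral_nuclear_equality; lra.
split=> //; split; first by rewrite -XYM mxdotDl; lra.
split; first lra.
by split; [move=> i; exact: comp | rewrite spZ ooZ mulfK // lt0r_neq0].
Qed.
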